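(* Let $p>1$ and $1/p+1/q=1$. Let $\lambda>0$ and let $r,s$ be real numbers with $r+s=\lambda$. Let $k_\lambda:(0,\infty)\times(0,\infty)\to(0,\infty)$ be a measurable function homogeneous of degree $-\lambda$ (i.e. $k_\lambda(ux,uy)=u^{-\lambda}k_\lambda(x,y)$ for all $u,x,y>0$), and assume that $$k_\lambda(r):=\int_0^\infty k_\lambda(u,1)\,u^{r-1}\,du$$ is a (finite) positive number. Assume that the functions $u\mapsto k_\lambda(u,1)u^{r-1}$ and $u\mapsto k_\lambda(1,u)u^{s-1}$ are decreasing on $(0,\infty)$ and strictly decreasing on some subinterval of $(0,\infty)$. Let $a_n,b_n\ge 0$ ($n\ge1$) with $0<\sum_{n=1}^\infty a_n^p<\infty$ and $0<\sum_{n=1}^\infty b_n^q<\infty$, and let $A_n=\sum_{k=1}^n a_k$, $B_n=\sum_{k=1}^n b_k$. Then $$\sum_{n=1}^\infty\sum_{m=1}^\infty m^{r-\frac1q-1}n^{s-\frac1p-1}k_\lambda(m,n)A_mB_n< pq\,k_\lambda(r)\Big[\sum_{n=1}^\infty a_n^p\Big]^{1/p}\Big[\sum_{n=1}^\infty b_n^q\Big]^{1/q}$$ and $$\sum_{n=1}^\infty\Big[\sum_{m=1}^\infty m^{r-\frac1q-1}n^{s-\frac1p}k_\lambda(m,n)A_m\Big]^p<[q\,k_\lambda(r)]^p\sum_{n=1}^\infty a_n^p,$$ and the constant factors $pq\,k_\lambda(r)$ and $[q\,k_\lambda(r)]^p$ are the best possible.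
   Context: A measurable function $k_\lambda(x,y)$ on $(0,\infty)^2$ with $k_\lambda(ux,uy)=u^{-\lambda}k_\lambda(x,y)$ for all $u,x,y>0$ is called homogeneous of degree $-\lambda$. ''Best possible'' means that the inequality fails (for some admissible sequences) if the constant is replaced by any smaller positive constant. *)

(* Defs.v *)
From HB Require Import structures.
From mathcomp Require Import all_boot all_order all_algebra.
From mathcomp Require Import all_classical all_reals all_analysis.
Set Implicit Arguments. Unset Strict Implicit. Unset Printing Implicit Defensive.
Import Order.TTheory GRing.Theory Num.Theory.
Local Open Scope ring_scope.

Definition psum {R : realType} (a : nat -> R) (n : nat) : R :=
  \sum_(1 <= k < n.+1) a k.

Definition pilot_series1 {R : realType} (F : nat -> R) : \bar R :=
  (\sum_(1 <= n <oo) (F n)%:E)%E.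

Definition decr_pos {R : realType} (f : R -> R) : Prop :=
  forall x y : R, 0 < x -> x <= y -> f y <= f x.

Definition strict_decr_somewhere {R : realType} (f : R -> R) : Prop :=
  exists a b : R, 0 < a /\ a < b /\
    forall x y : R, a <= x -> x < y -> y <= b -> f y < f x.

Definition admissible {R : realType} (p : R) (a : nat -> R) : Prop :=
  (forall n, 0 <= a n) /\ (0 < pilot_series1 (fun n => powR (a n) p) < +oo)%E.

Definition lhs1 {R : realType} (k : R -> R -> R) (p q r s : R)
    (a b : nat -> R) : \bar R :=
  (\sum_(1 <= n <oo) \sum_(1 <= m <oo)
     ((m%:R) `^ (r - q^-1 - 1) * (n%:R) `^ (s - p^-1 - 1)
        * k m%:R n%:R * psum a m * psum b n)%:E)%E.

Definition lhs2 {R : realType} (k : R -> R -> R) (p q r s : R)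
    (a : nat -> R) : \bar R :=
  (\sum_(1 <= n <oo)
     poweR (\sum_(1 <= m <oo)
       ((m%:R) `^ (r - q^-1 - 1) * (n%:R) `^ (s - p^-1)
          * k m%:R n%:R * psum a m)%:E) p)%E.

(* Main.v *)
Require Import Defs.
From HB Require Import structures.
From mathcomp Require Import all_boot all_order all_algebra.
From mathcomp Require Import all_classical all_reals all_analysis.
From mathcomp Require Import measurable_realfun ring lra.
Import Order.TTheory GRing.Theory Num.Theory.
Import numFieldNormedType.Exports.
Local Open Scope ring_scope.
Local Open Scope classical_set_scope.

(* With f u = k u 1 u^(r-1), homogeneity gives
   m^(r-1) n^(s-1) k m n = n^-2 f (m/n) = m^-2 g (n/m), where g u = k 1 u u^(s-1).
   As f and g decrease, comparing sums with integrals bounds the row and column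
   sums of this matrix by kr/n and kr/m.  Both left-hand sides are expressions
   in this matrix and the averages A_m/m, B_n/n, so Schur's test (Hoelder and
   Tonelli) bounds them by the norms of the averages.  The strict inequality
   then comes from Hardy's inequality alone, proved by Elliott's telescoping
   argument and Young's inequality.
   Sharpness: for a_n = n^(-1/p), b_n = n^(-1/q) truncated at N, the sums of the
   a_n^p and b_n^q are the harmonic sum H_N, the averages are asymptotically
   q a_n and p b_n, and the truncated row sums of the matrix are nearly kr/n
   except for a bounded part of H_N. *)

(** * Series of nonnegative terms *)

Lemma nneseries_shift1 (R : realType) (f : nat -> \bar R) :
  (forall i, 0 <= f i.+1)%E ->
  (\sum_(1 <= i <oo) f i = \sum_(i <oo) f i.+1)%E.
Proof.
(* [f 0] has no sign hypothesis, so it is first replaced by 0; a sum from 1 does not see it. *)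
move=> f0; have f1 i : (0 <= if i is j.+1 then f j.+1 else 0)%E by case: i.
transitivity (\sum_(1 <= i <oo) if i is j.+1 then f j.+1 else 0)%E.
  by rewrite eseries_cond [RHS]eseries_cond; apply: eq_eseriesr => -[].
by rewrite -nneseries_addn//; apply: eq_eseriesr => i _; rewrite addn1.
Qed.

(** This is the integral form of Hölder for the counting measure on [nat], whose norms are
    series. *)
Lemma hoelder_nneseries (R : realType) (p q : R) (u v : nat -> R) :
  0 < p -> 0 < q -> p^-1 + q^-1 = 1 ->
  (forall i, 0 <= u i) -> (forall i, 0 <= v i) ->
  (\sum_(i <oo) (u i * v i)%:E <=
   poweR (\sum_(i <oo) (u i `^ p)%:E) p^-1 *
   poweR (\sum_(i <oo) (v i `^ q)%:E) q^-1)%E.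
Proof.
move=> p0 q0 pq u0 v0.
have mf (f : nat -> R) : measurable_fun [set: nat] f by [].
have := @hoelder _ nat R counting u v p q (mf u) (mf v) p0 q0 pq.
rewrite !Lnorm_counting//.
under eq_eseriesr => i _ do
  rewrite poweRe1 ?abse_ge0//= ger0_norm ?mulr_ge0//.
under [X in (_ <= poweR X _ * _)%E]eq_eseriesr => i _ do rewrite /= ger0_norm//.
under [X in (_ <= _ * poweR X _)%E]eq_eseriesr => i _ do rewrite /= ger0_norm//.
rewrite invr1 poweRe1//; apply: nneseries_ge0 => i _ _.
by rewrite lee_fin mulr_ge0.
Qed.
Arguments hoelder_nneseries {R p q} u v.

Lemma hoelder_nneseries_root (R : realType) (p q : R) (u v : nat -> R) :
  0 < p -> 0 < q -> p^-1 + q^-1 = 1 ->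
  (forall i, 0 <= u i) -> (forall i, 0 <= v i) ->
  (\sum_(i <oo) (u i `^ p^-1 * v i `^ q^-1)%:E <=
   poweR (\sum_(i <oo) (u i)%:E) p^-1 * poweR (\sum_(i <oo) (v i)%:E) q^-1)%E.
Proof.
move=> p0 q0 pq u0 v0.
have rootK (x : R) (w : nat -> R) : 0 < x -> (forall i, 0 <= w i) ->
    w = fun i => (w i `^ x^-1) `^ x.
  by move=> x0 w0; apply/funext => i; rewrite -powRrM mulVf ?gt_eqF// powRr1.
rewrite [in X in (_ <= X * _)%E](rootK p u)// [in X in (_ <= _ * X)%E](rootK q v)//.
by apply: hoelder_nneseries => // i; exact: powR_ge0.
Qed.
Arguments hoelder_nneseries_root {R p q} u v.

(** The summand splits as [(K i j * x i * u i ^ p) ^ (1/p)] times [(K i j * x j) ^ (1/q)]. Hölder in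
    [i] leaves a second factor bounded through [Kj]; raising to the power [p], summing over [j] and
    exchanging the sums leaves the sums bounded by [Ki]. *)
Lemma schur_test (R : realType) (p q kappa : R) (K : nat -> nat -> R)
    (x u : nat -> R) :
  0 < p -> 0 < q -> p^-1 + q^-1 = 1 -> 0 <= kappa ->
  (forall i j, 0 <= K i j) -> (forall i, 0 < x i) -> (forall i, 0 <= u i) ->
  (forall j, \sum_(i <oo) (K i j)%:E <= (kappa / x j)%:E)%E ->
  (forall i, \sum_(j <oo) (K i j)%:E <= (kappa / x i)%:E)%E ->
  (\sum_(j <oo)
     poweR (\sum_(i <oo) (K i j * (x i `^ p^-1 * x j `^ q^-1) * u i)%:E) p
   <= (kappa `^ p)%:E * \sum_(i <oo) (u i `^ p)%:E)%E.
Proof.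
move=> p0 q0 pq k0 K0 x0 u0 Kj Ki.
have Kxu0 i j : 0 <= K i j * x i * u i `^ p.
  by rewrite !mulr_ge0 ?powR_ge0// ltW.
have row j : (poweR (\sum_(i <oo) (K i j * (x i `^ p^-1 * x j `^ q^-1) * u i)%:E) p
    <= (kappa `^ (p / q))%:E * \sum_(i <oo) (K i j * x i * u i `^ p)%:E)%E.
  have E i : K i j * (x i `^ p^-1 * x j `^ q^-1) * u i =
     (K i j * x i * u i `^ p) `^ p^-1 * (K i j * x j) `^ q^-1.
    rewrite !powRM ?mulr_ge0 ?powR_ge0 ?(ltW (x0 _))//.
    rewrite -powRrM mulfV ?gt_eqF// powRr1//.
    have KE : K i j = K i j `^ p^-1 * K i j `^ q^-1.
      by rewrite -powRD pq ?powRr1// oner_eq0.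
    rewrite {1}KE; ring.
  under eq_eseriesr => i _ do rewrite E.
  have S0 : (0 <= \sum_(i <oo) (K i j * x i * u i `^ p)%:E)%E.
    by apply: nneseries_ge0 => i _ _; rewrite lee_fin.
  apply: (@le_trans _ _ (poweR (poweR (\sum_(i <oo) (K i j * x i * u i `^ p)%:E) p^-1
        * (kappa `^ q^-1)%:E) p)%E).
    apply: gt0_ler_poweR => //; first exact: ltW.
    - rewrite in_itv/= leey andbT; apply: nneseries_ge0 => i _ _.
      by rewrite lee_fin mulr_ge0 ?powR_ge0.
    - by rewrite in_itv/= leey andbT mule_ge0 ?poweR_ge0// lee_fin powR_ge0.
    apply: (le_trans (hoelder_nneseries_root _ _ p0 q0 pq (Kxu0^~ j) _)).
      by move=> i; rewrite mulr_ge0// ltW.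
    rewrite lee_wpmul2l ?poweR_ge0//.
    under eq_eseriesr => i _ do rewrite mulrC EFinM.
    rewrite nneseriesZl//; last by move=> i _; rewrite lee_fin.
    rewrite -poweR_EFin; apply: gt0_ler_poweR.
    - by rewrite invr_ge0 ltW.
    - rewrite in_itv/= leey andbT mule_ge0 ?lee_fin ?(ltW (x0 _))//.
      by apply: nneseries_ge0 => i _ _; rewrite lee_fin.
    - by rewrite in_itv/= leey andbT lee_fin.
    apply: (le_trans (lee_wpmul2l _ (Kj j))); first by rewrite lee_fin ltW.
    by rewrite -EFinM mulrC divfK ?gt_eqF.
  rewrite poweRM ?poweR_ge0 ?lee_fin ?powR_ge0//.
  rewrite -poweRrM mulVf ?gt_eqF// poweRe1//.
  by rewrite poweR_EFin -powRrM muleC (mulrC q^-1).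
apply: (@le_trans _ _ (\sum_(j <oo) ((kappa `^ (p / q))%:E *
    \sum_(i <oo) (K i j * x i * u i `^ p)%:E))%E).
  by apply: lee_nneseries => [j _ _|j _]; [exact: poweR_ge0|exact: row].
rewrite nneseriesZl; last first.
  by move=> j _; apply: nneseries_ge0 => i _ _; rewrite lee_fin.
rewrite nneseries_interchange; last by move=> j i; rewrite lee_fin.
(* Hölder contributes [kappa ^ (p / q)] and [Ki] one more [kappa]; the exponents add up since
   [p / q = p - 1]. *)
have -> : kappa `^ p = kappa `^ (p / q) * kappa.
  have -> : p / q = p - 1.
    by have -> : q^-1 = 1 - p^-1 by [lra]; field; rewrite gt_eqF.
  by rewrite [RHS]mulrC mulr_powRB1.
rewrite EFinM -muleA lee_wpmul2l// ?lee_fin ?powR_ge0//.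
rewrite -nneseriesZl//; last by move=> i _; rewrite lee_fin powR_ge0.
apply: lee_nneseries => [i _ _|i _].
  by apply: nneseries_ge0 => j _ _; rewrite lee_fin.
under eq_eseriesr => j _ do rewrite -mulrA mulrC EFinM.
rewrite nneseriesZl; last by move=> j _; rewrite lee_fin.
apply: (le_trans (lee_wpmul2l _ (Ki i))).
  by rewrite lee_fin mulr_ge0 ?powR_ge0// ltW.
rewrite -!EFinM lee_fin.
have xi := x0 i.
suff -> : x i * u i `^ p * (kappa / x i) = kappa * u i `^ p by [].
by field; rewrite gt_eqF.
Qed.

(** * Hardy's inequality *)

Lemma conjugate_gt1 (R : realType) (p q : R) :
  1 < p -> p^-1 + q^-1 = 1 -> 1 < q.
Proof.
move=> p1 pq; have p0 : 0 < p by rewrite (lt_trans ltr01).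
have qi : q^-1 = 1 - p^-1 by [lra].
have qi0 : 0 < q^-1 by rewrite qi subr_gt0 invf_lt1.
have q0 : 0 < q by rewrite -invr_gt0.
by rewrite -[q]invrK invf_gt1// qi ltrBlDr ltrDl invr_gt0.
Qed.
Arguments conjugate_gt1 {R p q}.

Lemma conjugateM (R : realType) (p q : R) :
  1 < p -> p^-1 + q^-1 = 1 -> (p - 1) * q = p.
Proof.
move=> p1 pq; have q1 := conjugate_gt1 p1 pq.
have -> : q = (1 - p^-1)^-1 by rewrite -pq addrC addKr invrK.
by field; rewrite !gt_eqF ?subr_gt0// (lt_trans ltr01).
Qed.
Arguments conjugateM {R p q}.

(** Young's inequality for [x] and [y ^ (p - 1)], whose [q]-th power is [y ^ p] by [conjugateM]. *)
Lemma young_powRB1 (R : realType) (p q x y : R) :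
  1 < p -> p^-1 + q^-1 = 1 -> 0 <= x -> 0 <= y ->
  x * y `^ (p - 1) <= x `^ p / p + y `^ p / q.
Proof.
move=> p1 pq x0 y0; have q1 := conjugate_gt1 p1 pq.
have := @conjugate_powR R x (y `^ (p - 1)) p q x0 (powR_ge0 _ _).
by rewrite -powRrM (conjugateM p1 pq); apply=> //; lra.
Qed.

(** The strictness in Hardy's inequality originates here. The zero cases are separated so that
    [ln (x / y)] can serve as parameter. *)
Lemma young_powRB1_lt (R : realType) (p q x y : R) :
  1 < p -> p^-1 + q^-1 = 1 -> 0 <= x -> 0 <= y -> x != y ->
  x * y `^ (p - 1) < x `^ p / p + y `^ p / q.
Proof.
move=> p1 pq; have q1 := conjugate_gt1 p1 pq.
have p0 : 0 < p by [lra]. have q0 : 0 < q by [lra].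
rewrite le_eqVlt => /predU1P[<- y0 y0'|x0].
  rewrite mul0r powR0 ?gt_eqF// mul0r add0r divr_gt0// powR_gt0//.
  by rewrite lt_neqAle y0 y0'.
rewrite le_eqVlt => /predU1P[<- _|y0 xy].
  by rewrite !powR0 ?gt_eqF// ?subr_gt0// mulr0 mul0r addr0 divr_gt0// powR_gt0.
pose l := ln (x / y).
have l0 : l != 0.
  rewrite /l ln_eq0 ?divr_gt0//; apply: contra xy => /eqP xy1.
  by rewrite -[x](divfK (lt0r_neq0 y0)) xy1 mul1r.
have xE : x = y * expR l by rewrite lnK ?posrE ?divr_gt0// mulrC divfK// gt_eqF.
(* With x = y e^l and both sides divided by y^p e^l, the claim is the weighted sum
   of 1 + z < e^z at z = (p - 1) l and z = - l. *)
have e1 := @expR_gt1Dx R ((p - 1) * l).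
have e2 := @expR_gt1Dx R (- l).
have {}e1 : 1 + (p - 1) * l < expR ((p - 1) * l).
  by apply: e1; rewrite mulf_neq0//; apply/eqP; lra.
have {}e2 : 1 + - l < expR (- l) by apply: e2; rewrite oppr_eq0.
have xpE : x `^ p = y `^ p * expR l * expR ((p - 1) * l).
  rewrite xE powRM ?expR_ge0 ?(ltW y0)// -mulrA -expRD; congr (_ * _).
  by rewrite /powR gt_eqF ?expR_gt0// expRK; congr expR; ring.
have E : y `^ p = y `^ p * expR l * expR (- l).
  by rewrite -mulrA -expRD subrr expR0 mulr1.
have -> : x * y `^ (p - 1) = y `^ p * expR l.
  by rewrite xE mulrAC mulr_powRB1// ltW.
rewrite xpE {3}E -!mulrA -!mulrDr ltr_pM2l ?powR_gt0//.
rewrite -[ltLHS]mulr1 ltr_pM2l ?expR_gt0//.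
have a0 : 0 < p^-1 by rewrite invr_gt0. have b0 : 0 < q^-1 by rewrite invr_gt0.
have h : (1 + (p - 1) * l) * p^-1 + (1 - l) * q^-1 = 1.
  have -> : q^-1 = 1 - p^-1 by [lra]. by field; rewrite gt_eqF.
rewrite -{1}h ltrD// ltr_pM2r//.
Qed.

(* Elliott's inequality: the bracket telescopes when summed over n. *)
Lemma hardy_step (R : realType) (p q n a x y : R) :
  1 < p -> p^-1 + q^-1 = 1 -> 1 <= n -> 0 <= a -> 0 <= x -> 0 <= y ->
  a = n * x - (n - 1) * y ->
  x `^ p + q * (n * x `^ p - (n - 1) * y `^ p) <= q `^ p * a `^ p /\
  (q * a != x ->
   x `^ p + q * (n * x `^ p - (n - 1) * y `^ p) < q `^ p * a `^ p).
Proof.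
move=> p1 pq n1 a0 x0 y0 aE.
have q1 := conjugate_gt1 p1 pq; have p0 : 0 < p by [lra].
have q0 : 0 < q by [lra].
have pqM := conjugateM p1 pq.
rewrite -powRM//; last exact: ltW.
have Y2 := young_powRB1 R p q y x p1 pq y0 x0.
have XE : x * x `^ (p - 1) = x `^ p by rewrite mulr_powRB1.
move: Y2; set Z := x `^ (p - 1) in XE *; rewrite -XE; set Yp := y `^ p => Y2.
(* With [Z = x ^ (p - 1)], only the cross term [y * Z] needs Young's inequality; it enters
   negatively, so its upper bound [Y2] bounds [q * a * Z] from below. *)
have E : q * a * Z = q * n * (x * Z) - q * (n - 1) * (y * Z) by rewrite aE; ring.
have {}Y2 : q * a * Z >= q * n * (x * Z) - (n - 1) * (q / p * Yp + x * Z).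
  rewrite E lerD2l lerN2 [leLHS](_ : _ = (n - 1) * (q * (y * Z))); last by ring.
  rewrite ler_wpM2l ?subr_ge0//.
  rewrite [leRHS](_ : _ = q * (Yp / p + x * Z / q)); last by field; rewrite !gt_eqF.
  by rewrite ler_wpM2l// ltW.
(* After this identity the claim follows from a second use of Young, for [q * a] and [x]; this is
   the one that is strict when [q * a != x]. *)
have L : x * Z + q * (n * (x * Z) - (n - 1) * Yp) =
    p * (q * n * (x * Z) - (n - 1) * (q / p * Yp + x * Z) - x * Z / q).
  have qE : q = p / (p - 1) by rewrite -{1}pqM mulrC mulKf// gt_eqF// subr_gt0.
  by rewrite qE; field; rewrite !gt_eqF// subr_gt0.
have qa0 : 0 <= q * a by rewrite mulr_ge0// ltW.
rewrite L; split=> [|qax].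
  rewrite -ler_pdivlMl// lerBlDr [p^-1 * _]mulrC (le_trans Y2)// XE.
  exact: (young_powRB1 R p q _ _ p1 pq qa0 x0).
rewrite -ltr_pdivlMl// ltrBlDr [p^-1 * _]mulrC (le_lt_trans Y2)// XE.
exact: (young_powRB1_lt R p q _ _ p1 pq qa0 x0 qax).
Qed.
Arguments hardy_step {R p q} n a x y.

Lemma hardy (R : realType) (p q : R) (a : nat -> R) :
  1 < p -> p^-1 + q^-1 = 1 -> (forall i, 0 <= a i) ->
  (0 < \sum_(i <oo) (a i `^ p)%:E < +oo)%E ->
  (\sum_(i <oo) (((\sum_(k < i.+1) a k) / i.+1%:R) `^ p)%:E <
   (q `^ p)%:E * \sum_(i <oo) (a i `^ p)%:E)%E.
Proof.
move=> p1 pq a0 /andP[S0 Soo].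
have q1 := conjugate_gt1 p1 pq.
pose A n : R := \sum_(k < n) a k.
have A0 n : 0 <= A n by rewrite /A sumr_ge0.
(* [x n] averages the first [n] terms, so [a n] is paired with [x n.+1]; [x 0 = 0 / 0 = 0] enters
   only with coefficient 0. *)
pose x n : R := A n / n%:R.
have x0 n : 0 <= x n by rewrite /x divr_ge0.
have xn n : n.+1%:R * x n.+1 = A n.+1 by rewrite /x mulrC divfK.
pose T n : R := q * (n%:R * x n `^ p).
have T0 n : 0 <= T n by rewrite /T !mulr_ge0 ?powR_ge0//; lra.
have nT n : q * (n.+1%:R * x n.+1 `^ p - (n.+1%:R - 1) * x n `^ p) = T n.+1 - T n.
  by rewrite /T mulrBr -natr1 addrK.
have aE n : a n = n.+1%:R * x n.+1 - (n.+1%:R - 1) * x n.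
  rewrite xn -natr1 addrK; case: n => [|n].
    by rewrite mul0r subr0 /A big_ord1.
  by rewrite xn /A [in RHS]big_ord_recr/= addrAC subrr add0r.
have step n := hardy_step n.+1%:R (a n) (x n.+1) (x n) p1 pq
  (eq_ind_r is_true isT (ler1n R n.+1)) (a0 n) (x0 _) (x0 _) (aE n).
have step_le n : x n.+1 `^ p + (T n.+1 - T n) <= q `^ p * a n `^ p.
  by have [+ _] := step n; rewrite nT.
(* Equality in every step would force [(n + 1) q A_(n+1) = A_(n+1)] whenever [A_n = 0], hence
   [A = 0] by induction, against the positive sum. *)
have [n qan] : exists n, q * a n != x n.+1.
  apply/not_existsP => qa.
  have {}qa n : q * a n = x n.+1 by apply/eqP/negPn/negP/qa.
  have An n : A n = 0.
    elim: n => [|n IHn]; first by rewrite /A big_ord0.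
    have AS : A n.+1 = a n by rewrite /A big_ord_recr/= -/(A n) IHn add0r.
    have := xn n; rewrite -qa -AS mulrA => /eqP.
    rewrite -subr_eq0 -[X in _ - X]mul1r -mulrBl mulf_eq0 => /orP[|/eqP//].
    by rewrite subr_eq0 gt_eqF// (lt_le_trans q1)// ler_peMl ?ler1n//; lra.
  move: S0; rewrite eseries0 ?ltxx// => i _ _.
  by rewrite aE /x !An !mul0r !mulr0 subrr powR0// gt_eqF//; lra.
have step_lt : x n.+1 `^ p + (T n.+1 - T n) < q `^ p * a n `^ p.
  by have [_] := step n; rewrite nT; exact.
pose d := q `^ p * a n `^ p - (x n.+1 `^ p + (T n.+1 - T n)).
have d0 : 0 < d by rewrite subr_gt0.
(* The gap [d] of the one strict step is kept in all later partial sums, so it survives the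
   limit. *)
have part N : \sum_(i < N) x i.+1 `^ p + T N + (if (n < N)%N then d else 0) <=
    q `^ p * \sum_(i < N) a i `^ p.
  elim: N => [|N IHN].
    by rewrite !big_ord0 mulr0 /T mul0r mulr0 !addr0.
  rewrite !big_ord_recr/= mulrDr.
  have [nN|nN] := eqVneq n N.
    subst N; move: IHN; rewrite ltnn ltnSn /d.
    move: (T n) (T n.+1) (x n.+1 `^ p) (a n `^ p) (\sum_(i < n) _) (\sum_(i < n) _).
    by move=> *; lra.
  rewrite ltnS leq_eqVlt (negbTE nN)/=; have := step_le N.
  move: IHN; case: ifP => _;
  move: (T N) (T N.+1) (x N.+1 `^ p) (a N `^ p) (\sum_(i < N) _) (\sum_(i < N) _).
    by move=> *; lra.
  by move=> *; lra.
have Sfin : (\sum_(i <oo) (a i `^ p)%:E)%E \is a fin_num.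
  by rewrite ge0_fin_numE// ltW.
have Sxd : (\sum_(i <oo) (x i.+1 `^ p)%:E + d%:E <=
    (q `^ p)%:E * \sum_(i <oo) (a i `^ p)%:E)%E.
  rewrite -(fineK Sfin) -EFinM.
  rewrite -leeBrDr// -EFinB; apply: lime_le.
    by apply: is_cvg_nneseries => i _ _; rewrite lee_fin powR_ge0.
  near=> N; rewrite sumEFin lee_fin big_mkord.
  have aN : \sum_(i < N) a i `^ p <= fine (\sum_(i <oo) (a i `^ p)%:E)%E.
    rewrite -lee_fin fineK// -sumEFin -(big_mkord xpredT (fun i => (a i `^ p)%:E)).
    by apply: nneseries_lim_ge => i _ _; rewrite lee_fin powR_ge0.
  have nN : (n < N)%N by near: N; exists n.+1.
  have := part N; rewrite nN => /le_trans/(_ (ler_wpM2l (powR_ge0 _ _) aN)).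
  by have := T0 N; lra.
(* Adding [d] is a strict increase only for a finite sum; finiteness comes from [Sxd] itself. *)
apply: lt_le_trans (Sxd); rewrite lteDl ?lte_fin//.
have Sx0 : (0 <= \sum_(i <oo) (x i.+1 `^ p)%:E)%E.
  by apply: nneseries_ge0 => i _ _; rewrite lee_fin powR_ge0.
rewrite ge0_fin_numE// -(lteD2rE _ _ (erefl : d%:E \is a fin_num)).
apply: (le_lt_trans Sxd).
by rewrite -(fineK Sfin) -EFinM addye// ltry.
Unshelve. all: by end_near. Qed.
Arguments hardy {R p q} a.

(** * Sums and integrals of monotone functions *)

Lemma is_derive_oppV (R : realType) (x : R) : x != 0 ->
  is_derive x 1 (fun u : R => - u^-1) (x ^- 2).
Proof.
move=> x0; have dV : is_derive x 1 (fun u : R => u^-1) (- x ^- 2 *: 1).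
  exact: (@is_deriveV R id x 1 1 x0 (is_derive_id x 1)).
have := is_deriveN dV.
by rewrite scaler1 opprK.
Qed.

Lemma continuous_exprVn (R : realType) (n : nat) (x : R) :
  x != 0 -> {for x, continuous (fun u : R => u ^- n)}.
Proof.
move=> x0; apply: cvgV; first by rewrite expf_neq0.
exact: exprn_continuous.
Qed.

Lemma integral_exprV2 (R : realType) (x y : R) : 0 < x -> x < y ->
  (\int[lebesgue_measure]_(u in `]x, y]) (u ^- 2)%:E = (x^-1 - y^-1)%:E)%E.
Proof.
move=> x0 xy.
have cf : {within `[x, y], continuous (fun u : R => u ^- 2)}.
  apply: continuous_in_subspaceT => u; rewrite inE/= in_itv/= => /andP[xu _].
  by apply: continuous_exprVn; rewrite gt_eqF// (lt_le_trans x0).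
rewrite integral_itv_obnd_cbnd; last first.
  apply/measurable_EFinP; apply: (@measurable_funS _ _ _ _ `[x, y]%classic) => //.
    by apply: subset_itvr; rewrite bnd_simp.
  by apply: subspace_continuous_measurable_fun.
rewrite (@continuous_FTC2 _ _ (fun u => - u^-1))//.
- by rewrite -EFinB opprK addrC.
- split.
  + move=> u; rewrite in_itv/= => /andP[xu _].
    by have [] := @is_derive_oppV R u (lt0r_neq0 (lt_trans x0 xu)).
  + apply: cvg_at_right_filter; apply: cvgN; apply: cvgV => //.
    by rewrite gt_eqF.
  + apply: cvg_at_left_filter; apply: cvgN; apply: cvgV => //.
    by rewrite gt_eqF// (lt_trans x0).
- move=> u; rewrite in_itv/= => /andP[xu _]; rewrite derive1E.
  by have := @is_derive_oppV R u (lt0r_neq0 (lt_trans x0 xu)) => /@derive_val->.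
Qed.

Lemma integral_exprV2_infty (R : realType) (x : R) : 0 < x ->
  (\int[lebesgue_measure]_(u in `]x, +oo[) (u ^- 2)%:E = (x^-1)%:E)%E.
Proof.
move=> x0.
have cf : {within `[x, +oo[, continuous (fun u : R => u ^- 2)}.
  apply: continuous_in_subspaceT => u; rewrite inE/= in_itv/= andbT => xu.
  by apply: continuous_exprVn; rewrite gt_eqF// (lt_le_trans x0).
rewrite integral_itv_obnd_cbnd; last first.
  apply/measurable_EFinP; apply: (@measurable_funS _ _ _ _ `[x, +oo[%classic) => //.
    by apply: subset_itvr; rewrite bnd_simp.
  by apply: subspace_continuous_measurable_fun.
rewrite (@ge0_continuous_FTC2y _ _ (fun u => - u^-1) _ 0)//.
- by rewrite -EFinB opprK add0r.
- by move=> u xu; rewrite invr_ge0 sqr_ge0.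
- rewrite -oppr0; apply: cvgN; apply/gtr0_cvgV0; last exact: cvg_id.
  by near=> u; near: u; exact: nbhs_pinfty_gt.
- by move=> u xu; have [] := @is_derive_oppV R u (lt0r_neq0 (lt_trans x0 xu)).
- apply: cvg_at_right_filter; apply: cvgN; apply: cvgV => //.
  by rewrite gt_eqF.
- move=> u; rewrite in_itv/= andbT => xu; rewrite derive1E.
  by have := @is_derive_oppV R u (lt0r_neq0 (lt_trans x0 xu)) => /@derive_val->.
Unshelve. all: by end_near. Qed.

Section pos_integral.
Variables (R : realType) (f : R -> R).
Hypotheses (f0 : forall u, 0 < u -> 0 <= f u).
Hypothesis mf : measurable_fun (`]0, +oo[%classic : set R) f.

Local Notation itg A := (\int[lebesgue_measure]_(u in A) (f u)%:E)%E.

Lemma itv_pos (x : R) (b : itv_bound R) : 0 <= x ->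
  [set` Interval (BRight x) b] `<=` `]0, +oo[.
Proof.
move=> x0 u; rewrite /= !in_itv/= => /andP[xu _].
by rewrite (le_lt_trans x0 xu).
Qed.

Lemma measurable_fun_pos (A : set R) : measurable A -> A `<=` `]0, +oo[ ->
  measurable_fun A (fun u => (f u)%:E).
Proof.
move=> mA A0; apply/measurable_EFinP.
by apply: (measurable_funS _ A0 mf).
Qed.

Lemma EFin_pos (A : set R) : A `<=` `]0, +oo[ ->
  forall u, A u -> (0 <= (f u)%:E)%E.
Proof. by move=> A0 u /A0/=; rewrite in_itv/= andbT lee_fin; exact: f0. Qed.

Lemma itg_cat (x y : R) (b : itv_bound R) : 0 <= x -> x <= y -> (BRight y <= b)%O ->
  itg [set` Interval (BRight x) b] =
  (itg `]x, y] + itg [set` Interval (BRight y) b])%E.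
Proof.
move=> x0 xy yb; have xyb : (BRight x <= BRight y)%O by rewrite bnd_simp.
rewrite (@itv_bndbnd_setU _ _ _ (BRight y))// ge0_integral_setU//.
- apply: measurable_fun_pos; first exact: measurableU.
  by rewrite -itv_bndbnd_setU//; exact: itv_pos.
- by apply: EFin_pos; rewrite -itv_bndbnd_setU//; exact: itv_pos.
- rewrite disj_set2E; apply/eqP/seteqP; split => // u [/=].
  rewrite !in_itv/= => /andP[_ uy] /andP[yu _].
  by move: yu; rewrite ltNge uy.
Qed.

Lemma le_itg (A B : set R) : measurable A -> measurable B ->
  A `<=` B -> B `<=` `]0, +oo[ -> (itg A <= itg B)%E.
Proof.
move=> mA mB AB B0; apply: ge0_subset_integral => //.
- exact: measurable_fun_pos.
- exact: EFin_pos.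
Qed.

Lemma itg_telescope (t : nat -> R) m n :
  (forall i, 0 <= t i) -> (forall i, t i <= t i.+1) -> (m <= n)%N ->
  itg `]t m, t n] = (\sum_(m <= i < n) itg `]t i, t i.+1])%E.
Proof.
move=> t0 tS mn; rewrite -(subnKC mn); elim: (n - m)%N => [|d IHd].
  by rewrite addn0 big_geq// set_itvoc0 integral_set0.
rewrite addnS big_nat_recr/= ?leq_addr// -IHd; apply: itg_cat => //.
  by apply: (@homo_leq _ t (fun x y => x <= y)); rewrite ?leq_addr// => ? ? ?; exact: le_trans.
by rewrite bnd_simp.
Qed.

Hypothesis fdecr : forall x y, 0 < x -> x <= y -> f y <= f x.

Lemma itg_ge_right (x y : R) : 0 <= x -> x <= y ->
  (((y - x) * f y)%:E <= itg `]x, y])%E.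
Proof.
move=> x0; rewrite le_eqVlt => /predU1P[<-|xy].
  by rewrite subrr mul0r; apply: integral_ge0; apply: EFin_pos; exact: itv_pos.
have y0 : 0 < y by exact: le_lt_trans xy.
have -> : ((y - x) * f y)%:E = (\int[lebesgue_measure]_(u in `]x, y]) (cst (f y)%:E) u)%E.
  by rewrite integral_cst//= lebesgue_measure_itv/= lte_fin xy mulrC EFinM EFinB.
apply: ge0_le_integral => //.
- by move=> u _; rewrite lee_fin f0.
- by apply: measurable_fun_pos => //; exact: itv_pos.
- move=> u /=; rewrite in_itv/= lee_fin => /andP[xu uy].
  by apply: fdecr => //; exact: le_lt_trans xu.
Qed.

Lemma itg_le_left (x y : R) : 0 < x -> x <= y ->
  (itg `]x, y] <= ((y - x) * f x)%:E)%E.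
Proof.
move=> x0; rewrite le_eqVlt => /predU1P[<-|xy].
  by rewrite subrr mul0r set_itvoc0 integral_set0.
have -> : ((y - x) * f x)%:E = (\int[lebesgue_measure]_(u in `]x, y]) (cst (f x)%:E) u)%E.
  by rewrite integral_cst//= lebesgue_measure_itv/= lte_fin xy mulrC EFinM EFinB.
apply: ge0_le_integral => //.
- by apply: EFin_pos; apply: itv_pos; exact: ltW.
- by apply: measurable_fun_pos => //; apply: itv_pos; exact: ltW.
- by move=> u /=; rewrite in_itv/= lee_fin => /andP[xu uy]; apply: fdecr => //; exact: ltW.
Qed.

(** Since [f] decreases, each term is a rectangle below its graph with height taken at the right end
    of a cell of length [h]. *)
Lemma riemann_sum_le (h : R) : 0 < h ->
  (\sum_(i <oo) (h * f (h * i.+1%:R))%:E <= itg `]0%R, +oo[)%E.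
Proof.
move=> h0; have hi0 i : 0 <= h * i%:R by rewrite mulr_ge0// ltW.
apply: lime_le.
  apply: is_cvg_nneseries => i _ _.
  by rewrite lee_fin mulr_ge0 ?f0 ?mulr_gt0// ltW.
near=> N; apply: (@le_trans _ _ (itg `](h * 0%:R)%R, (h * N%:R)%R])); last first.
  by apply: le_itg => //; exact: itv_pos.
rewrite (itg_telescope (fun i => h * i%:R))//; last first.
  by move=> i; rewrite ler_pM2l// ler_nat.
apply: lee_sum => i _.
apply: le_trans (itg_ge_right _ _ (hi0 i) _); last by rewrite ler_pM2l// ler_nat.
by rewrite lee_fin -mulrBr -natrB// subSnn mulr1.
Unshelve. all: by end_near. Qed.

(** Here each term is a rectangle above the graph on the cell to the right of its node. The first
    node is thus positive, and [f] may be unbounded at 0. *)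
Lemma riemann_sum_ge (h : R) m n : 0 < h -> (m <= n)%N ->
  (itg `](h * m.+1%:R)%R, (h * n.+1%:R)%R] <=
   \sum_(m <= i < n) (h * f (h * i.+1%:R))%:E)%E.
Proof.
move=> h0 mn; have hi0 i : 0 < h * i.+1%:R by rewrite mulr_gt0.
rewrite (itg_telescope (fun i => h * i.+1%:R))//; last 2 first.
- by move=> i; exact: ltW.
- by move=> i; rewrite ler_pM2l// ler_nat.
apply: lee_sum => i _; apply: le_trans (itg_le_left _ _ (hi0 i) _) _.
  by rewrite ler_pM2l// ler_nat.
by rewrite lee_fin -mulrBr -natrB// subSnn mulr1.
Qed.

(** Monotone convergence along the intervals from [1 / (n + 1)] to [n + 1]; the strict bound on [c]
    is what a finite stage can reach. *)
Lemma itg_truncate (c : R) : (c%:E < itg `]0%R, +oo[)%E ->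
  exists e : R, 0 < e /\ (c%:E <= itg `]e, (e^-1)%R])%E.
Proof.
pose F n : set R := `]n.+1%:R^-1, n.+1%:R]%classic.
have Fpos n : F n `<=` `]0, +oo[ by apply: itv_pos; rewrite invr_ge0.
have ndF : nondecreasing_seq F.
  apply/nondecreasing_seqP => n; apply/subsetPset => u /=.
  rewrite /F/= !in_itv/= => /andP[nu un]; apply/andP; split.
    by apply: le_lt_trans nu; rewrite lef_pV2 ?posrE// ler_nat.
  by rewrite (le_trans un)// ler_nat.
have <- : \bigcup_n F n = `]0, +oo[%classic.
  apply/seteqP; split=> [u [n _ /Fpos//]|u]; rewrite /= in_itv/= andbT => u0.
  pose n := (Num.truncn u + Num.truncn u^-1)%N.
  exists n => //; rewrite /F/= in_itv/=; apply/andP; split.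
    rewrite invf_plt ?posrE//; apply: lt_le_trans (truncnS_gt _) _.
    by rewrite ler_nat ltnS leq_addl.
  by apply/ltW; apply: lt_le_trans (truncnS_gt _) _; rewrite ler_nat ltnS leq_addr.
have Fcvg : (itg (F i) @[i --> \oo] --> itg (\bigcup_n F n))%E.
  apply: ge0_nondecreasing_set_cvg_integral => //.
  - by move=> n; exact: measurable_itv.
  - by move=> n; apply: measurable_fun_pos; [exact: measurable_itv|exact: Fpos].
  - by move=> n; apply: EFin_pos; exact: Fpos.
rewrite -(cvg_lim _ Fcvg)// => cF.
have [||n _ /(_ n (leqnn n)) cn] := lte_lim _ _ cF.
- apply/nondecreasing_seqP => n.
  apply: le_itg => //; [exact: measurable_itv|exact: measurable_itv|].
  by rewrite -subsetEset; apply: ndF; exact: leqnSn.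
- by apply: cvgP; exact: Fcvg.
by exists n.+1%:R^-1; rewrite invr_gt0; split=> //; rewrite invrK.
Qed.

(* When f u = g u^-1 / u ^ 2, this says that g is decreasing.  It replaces the
   substitution u := u^-1, which would require a continuous f. *)
Hypothesis fincr : forall x y, 0 < x -> x <= y -> x ^+ 2 * f x <= y ^+ 2 * f y.

(** On [A], [fincr] makes [f u] at least [x ^+ 2 * f x] times [u ^- 2]. *)
Lemma itg_ge_sqr (x : R) (A : set R) : 0 < x -> measurable A -> A `<=` `]x, +oo[ ->
  ((x ^+ 2 * f x)%:E * \int[lebesgue_measure]_(u in A) (u ^- 2)%:E <= itg A)%E.
Proof.
move=> x0 mA Ax.
have A0 : A `<=` `]0, +oo[ by apply: subset_trans Ax _; apply: itv_pos; exact: ltW.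
have xA u : A u -> x < u by move=> /Ax; rewrite /= in_itv/= andbT.
have c0 : 0 <= x ^+ 2 * f x by rewrite mulr_ge0 ?sqr_ge0 ?f0.
have mg0 : measurable_fun (`]0, +oo[%classic : set R) (fun u : R => u ^- 2).
  apply: open_continuous_measurable_fun; first exact: interval_open.
  move=> u; rewrite inE/= in_itv/= andbT => u0.
  by apply: continuous_exprVn; rewrite gt_eqF.
have mg : measurable_fun A (fun u => (u ^- 2)%:E).
  by apply/measurable_EFinP; apply: (measurable_funS _ A0 mg0).
rewrite -ge0_integralZl_EFin//; last by move=> u _; rewrite lee_fin invr_ge0 sqr_ge0.
apply: ge0_le_integral => //.
- by move=> u _; rewrite -EFinM lee_fin mulr_ge0// invr_ge0 sqr_ge0.
- exact: measurable_funeM.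
- exact: measurable_fun_pos.
- move=> u /xA xu; rewrite -EFinM lee_fin.
  have u0 : 0 < u by exact: lt_trans xu.
  by rewrite ler_pdivrMr ?exprn_gt0// mulrC [leRHS]mulrC mulrC fincr// ltW.
Qed.

(** The points [t / (i + 1)] cut the half-line into []t, +oo[] and cells shrinking to 0, on each of
    which [u ^- 2] has integral [1 / t]. Applying [itg_ge_sqr] at the left end of each piece
    produces exactly one term. *)
Lemma riemann_sum_inv_le (t : R) : 0 < t ->
  (\sum_(i <oo) (t / i.+1%:R ^+ 2 * f (t / i.+1%:R))%:E <= itg `]0%R, +oo[)%E.
Proof.
move=> t0; have ti i : 0 < t / i.+1%:R by rewrite divr_gt0.
have part n : (\sum_(0 <= i < n.+1) (t / i.+1%:R ^+ 2 * f (t / i.+1%:R))%:E <=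
    itg `](t / n.+1%:R)%R, +oo[)%E.
  elim: n => [|n IHn].
    rewrite big_nat1; apply: le_trans (itg_ge_sqr _ _ (ti 0%N) _ _) => //.
    rewrite integral_exprV2_infty// -EFinM lee_fin divr1 expr1n divr1.
    suff -> : t ^+ 2 * f t / t = t * f t by [].
    by field; rewrite gt_eqF.
  have tn : t / n.+2%:R < t / n.+1%:R.
    by rewrite ltr_pM2l// ltf_pV2 ?posrE// ltr_nat.
  rewrite big_nat_recr//= (itg_cat _ (t / n.+1%:R)) ?(ltW tn) ?(ltW (ti _))//.
  rewrite addeC leeD//; apply: le_trans (itg_ge_sqr _ _ (ti n.+1) _ _) => //.
    rewrite integral_exprV2// -EFinM lee_fin.
    have -> : (t / n.+2%:R)^-1 - (t / n.+1%:R)^-1 = t^-1.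
      by rewrite !invf_div -mulrBl -natrB// subSnn mul1r.
    set F := f _; suff -> : (t / n.+2%:R) ^+ 2 * F / t = t / n.+2%:R ^+ 2 * F by [].
    have N0 : n.+2%:R != 0 :> R by rewrite pnatr_eq0.
    by move: N0 (lt0r_neq0 t0); move: (n.+2%:R : R) => N N0 t0'; field; rewrite N0.
  by apply: subset_itvl; rewrite bnd_simp.
apply: lime_le.
  apply: is_cvg_nneseries => i _ _.
  by rewrite lee_fin mulr_ge0 ?f0// divr_ge0 ?sqr_ge0// ltW.
near=> N; have N0 : (0 < N)%N by near: N; exists 1%N.
rewrite -(prednK N0); apply: le_trans (part _) _.
by apply: le_itg => //; apply: itv_pos; exact: ltW.
Unshelve. all: by end_near. Qed.

End pos_integral.

(** * Truncated power sequences *)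

Lemma series_harmonic_unbounded (R : realType) (A : R) :
  exists m, forall n, (m <= n)%N -> A <= \sum_(0 <= i < n) (i.+1%:R)^-1.
Proof.
have [[m Am]|H] := pselect (exists m, A <= \sum_(0 <= i < m) (i.+1%:R)^-1).
  exists m => n mn; apply: (le_trans Am).
  rewrite [leRHS](@big_cat_nat _ _ _ m)//= lerDl.
  by apply: sumr_ge0 => i _; rewrite invr_ge0.
exfalso; apply: (@dvg_harmonic R); apply: nondecreasing_is_cvgn.
  apply/nondecreasing_seqP => n; rewrite /series/= big_nat_recr//= lerDl.
  by rewrite invr_ge0.
exists A => _ [n _ <-]; rewrite leNgt; apply/negP => /ltW An.
by apply: H; exists n.
Qed.

(** Each of the [l * m] terms beyond the first [m] is at most [1 / m]. Stretching the range by a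
    fixed factor thus costs only a bounded amount. *)
Lemma series_harmonic_mul (R : realType) (l m : nat) :
  \sum_(0 <= i < l.+1 * m) (i.+1%:R)^-1 <=
  \sum_(0 <= i < m) (i.+1%:R)^-1 + l%:R :> R.
Proof.
rewrite (@big_cat_nat _ _ _ m)//= ?leq_pmull// lerD2l.
have [->|m0] := posnP m; first by rewrite muln0 big_geq.
apply: (@le_trans _ _ (\sum_(m <= i < l.+1 * m) m%:R^-1)).
  rewrite big_nat_cond [leRHS]big_nat_cond; apply: ler_sum => i.
  rewrite andbT => /andP[mi _].
  by rewrite lef_pV2 ?posrE ?ltr0n// ler_nat leqW.
rewrite big_const_nat iter_addr addr0 mulSn addKn -[leLHS]mulr_natr natrM mulrCA mulVf ?mulr1//.
by rewrite pnatr_eq0 -lt0n.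
Qed.

(** A discrete form of comparing the sum with the integral of [x ^ (- 1/p)], whose primitive is
    [q * x ^ (1/q)]: every increment of the primitive is at most the corresponding term. *)
Lemma sum_powRN_ge (R : realType) (p q : R) (n : nat) :
  1 < p -> p^-1 + q^-1 = 1 ->
  q * (n.+1%:R `^ q^-1 - 1) <= \sum_(i < n) i.+1%:R `^ (- p^-1).
Proof.
move=> p1 pq; have q1 := conjugate_gt1 p1 pq.
have p0 : 0 < p by [lra]. have q0 : 0 < q by [lra].
elim: n => [|n IHn]; first by rewrite big_ord0 powR1 subrr mulr0.
rewrite big_ord_recr/=.
suff : q * (n.+2%:R `^ q^-1 - n.+1%:R `^ q^-1) <= n.+1%:R `^ (- p^-1).
  by move: IHn; lra.
set m : R := n.+1%:R; have m0 : 0 < m by rewrite ltr0n.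
have nE : n.+2%:R = m * (1 + m^-1) :> R.
  by rewrite mulrDr mulr1 divff ?gt_eqF// natr1.
have mi0 : 0 < m^-1 by rewrite invr_gt0.
have mi1 : 0 <= 1 + m^-1 by rewrite addr_ge0// ltW.
rewrite nE powRM//.
have -> : m `^ (- p^-1) = m `^ q^-1 * m^-1.
  rewrite -[X in _ * X]powR_inv1 ?(ltW m0)// -powRD ?(gt_eqF m0) ?implybT//.
  by congr powR; lra.
(* Young with first factor 1 yields Bernoulli's inequality [(1 + 1/m) ^ (1/q) <= 1 + 1 / (q m)]. *)
have := @conjugate_powR R 1 ((1 + m^-1) `^ q^-1) p q ler01 (powR_ge0 _ _) p0 q0 pq.
rewrite mul1r powR1 -powRrM mulVf ?gt_eqF// powRr1// => B.
have -> : q * (m `^ q^-1 * (1 + m^-1) `^ q^-1 - m `^ q^-1) =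
    m `^ q^-1 * (q * ((1 + m^-1) `^ q^-1 - 1)) by ring.
rewrite ler_wpM2l ?powR_ge0//.
rewrite -ler_pdivlMl// lerBlDl.
apply: (le_trans B); rewrite mulrDl !mul1r [q^-1 * _]mulrC.
by move: pq; move: (m^-1 * q^-1) => x; lra.
Qed.

Lemma sum_powRN_asymp (R : realType) (p q c : R) :
  1 < p -> p^-1 + q^-1 = 1 -> c < 1 ->
  exists m, forall n, (m <= n)%N ->
    c * (q * n.+1%:R `^ q^-1) <= \sum_(i < n.+1) i.+1%:R `^ (- p^-1).
Proof.
move=> p1 pq c1; have q1 := conjugate_gt1 p1 pq.
have q0 : 0 < q by [lra].
(* From this index on [(1 - c) * n.+1 ^ (1/q) >= 1], which absorbs the [- 1] of [sum_powRN_ge]. *)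
exists (Num.truncn (((1 - c)^-1) `^ q)) => n mn.
have c1' : 0 < 1 - c by rewrite subr_gt0.
have ng : (1 - c)^-1 <= n.+1%:R `^ q^-1.
  have -> : (1 - c)^-1 = ((1 - c)^-1 `^ q) `^ q^-1.
    by rewrite -powRrM mulfV ?gt_eqF// powRr1// invr_ge0 ltW.
  apply: ge0_ler_powR; rewrite ?invr_ge0 ?nnegrE ?powR_ge0 ?(ltW q0)//.
  by apply/ltW/(lt_le_trans (truncnS_gt _)); rewrite ler_nat ltnS.
apply: (le_trans _ (sum_powRN_ge _ _ _ n.+1 p1 pq)).
rewrite mulrCA ler_pM2l//.
have nn : n.+1%:R `^ q^-1 <= n.+2%:R `^ q^-1 :> R.
  by apply: ge0_ler_powR; rewrite ?invr_ge0 ?nnegrE ?(ltW q0)// ler_nat.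
have : 1 <= (1 - c) * n.+1%:R `^ q^-1 by rewrite mulrC -ler_pdivrMr// div1r.
by move: nn; lra.
Qed.

(** * Lower bounds for truncated double sums *)

Lemma nneseries_ge_sub (R : realType) (f : nat -> \bar R) m n :
  (forall i, 0 <= f i)%E -> (\sum_(m <= i < n) f i <= \sum_(i <oo) f i)%E.
Proof.
move=> f0; rewrite (nneseries_split 0 m)// add0n.
apply: (@le_trans _ _ (\sum_(m <= i <oo) f i)%E).
  exact: nneseries_lim_ge.
by rewrite leeDr// sume_ge0.
Qed.

Lemma nneseries_trunc (R : realType) (f : nat -> \bar R) n :
  (forall i, 0 <= f i)%E ->
  (\sum_(i <oo) (if (i < n)%N then f i else 0) = \sum_(0 <= i < n) f i)%E.
Proof.
move=> f0; rewrite (nneseries_split 0 n); last by move=> i _; case: ifP.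
rewrite add0n eseries0 ?adde0; last by move=> i ni _; rewrite ltnNge ni.
rewrite big_nat_cond [RHS]big_nat_cond; apply: eq_bigr => i.
by rewrite andbT => /andP[_ ->].
Qed.

(* The row sums almost reach kappa / (j + 1) already on the indices i + 1 between
   e (j + 1) and (j + 1) / e. *)
Definition asymp_row_ge (R : realType) (K : nat -> nat -> R) (kappa : R) :=
  forall c, c < kappa -> exists e : R, 0 < e /\
    forall j m n, (m <= n)%N -> m.+1%:R <= e * j.+1%:R ->
      j.+1%:R <= e * n.+1%:R -> c / j.+1%:R <= \sum_(m <= i < n) K i j.

(** For [c < c1 < kappa], the indices [j] in [[j0, M)] contribute at least [c1 * (H M - H j0)],
    while [H N <= H M + l] because [N = (l + 1) M]. As [H] is unbounded, a large [M] lets [c1 - c]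
    pay for both constants. *)
Lemma asymp_row_ge_sum (R : realType) (K : nat -> nat -> R) (kappa c : R) m0 :
  (forall i j, 0 <= K i j) -> asymp_row_ge R K kappa -> 0 < c -> c < kappa ->
  exists N, (0 < N)%N /\
    c * \sum_(0 <= i < N) (i.+1%:R)^-1 <=
    \sum_(m0 <= j < N) \sum_(m0 <= i < N) K i j.
Proof.
move=> K0 Krow c0 ck.
pose c1 := (c + kappa) / 2; have cc1 : c < c1 by rewrite /c1; lra.
have c1k : c1 < kappa by rewrite /c1; lra.
have [e [e0 Ke]] := Krow c1 c1k.
pose H n : R := \sum_(0 <= i < n) (i.+1%:R)^-1.
pose l := Num.truncn e^-1.
have el : 1 <= e * l.+1%:R.
  by rewrite -ler_pdivrMl// mulr1; apply/ltW/truncnS_gt.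
(* [j0] secures the lower end [m0.+1 <= e * j.+1] for [j >= j0]; the choice of [l] secures the upper
   end [j.+1 <= e * N.+1] for [j < M]. *)
pose j0 := (m0 + Num.truncn (m0.+1%:R / e))%N.
have j0e : m0.+1%:R <= e * j0.+1%:R.
  rewrite -ler_pdivrMl// mulrC; apply/ltW/(lt_le_trans (truncnS_gt _)).
  by rewrite ler_nat ltnS leq_addl.
(* The threshold is [c * (H M + l) <= c1 * (H M - H j0)] solved for [H M]. *)
have [m1 Hm1] := series_harmonic_unbounded R ((c * l%:R + c1 * H j0) / (c1 - c)).
pose M := (maxn m1 j0).+1; pose N := (l.+1 * M)%N.
have MN : (M <= N)%N by rewrite leq_pmull.
have j0M : (j0 <= M)%N by rewrite leqW// leq_maxr.
have m0j0 : (m0 <= j0)%N by exact: leq_addr.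
have sub_sum (F : nat -> R) a b a' b' : (forall i, 0 <= F i) ->
    (a' <= a)%N -> (a <= b)%N -> (b <= b')%N ->
    \sum_(a <= i < b) F i <= \sum_(a' <= i < b') F i.
  move=> F0 aa ab bb.
  rewrite [leRHS](@big_cat_nat _ _ _ a)//=; last exact: leq_trans bb.
  rewrite [X in _ + X](@big_cat_nat _ _ _ b)//= addrCA lerDl addr_ge0//;
  by apply: sumr_ge0.
exists N; split; first by rewrite muln_gt0.
apply: (@le_trans _ _ (\sum_(j0 <= j < M) (c1 / j.+1%:R))); last first.
  apply: (@le_trans _ _ (\sum_(j0 <= j < M) \sum_(m0 <= i < N) K i j)).
    rewrite big_nat_cond [leRHS]big_nat_cond; apply: ler_sum => j.
    rewrite andbT => /andP[j0j jM]; apply: Ke.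
    - by rewrite (leq_trans m0j0)// (leq_trans j0M).
    - by rewrite (le_trans j0e)// ler_pM2l// ler_nat ltnS.
    - apply: (@le_trans _ _ M%:R); first by rewrite ler_nat.
      apply: (@le_trans _ _ (e * l.+1%:R * M%:R)); first by rewrite ler_peMl.
      by rewrite -mulrA -natrM ler_pM2l// ler_nat leqnSn.
  by apply: sub_sum => // j; apply: sumr_ge0.
rewrite -mulr_sumr.
have -> : \sum_(j0 <= j < M) (j.+1%:R)^-1 = H M - H j0.
  by rewrite /H [in RHS](@big_cat_nat _ _ _ j0)//= addrAC subrr add0r.
have := series_harmonic_mul R l M; rewrite -/N -/(H M) => HN.
have : (c * l%:R + c1 * H j0) / (c1 - c) <= H M.
  by apply: Hm1; rewrite leqW// leq_maxl.
rewrite ler_pdivrMr ?subr_gt0// => HM.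
apply: (@le_trans _ _ (c * (H M + l%:R))); first by rewrite ler_pM2l.
by move: HM; rewrite mulrBr mulrBr mulrDr; nra.
Qed.

(** * Extremal sequences and sharpness of the bilinear form *)

Lemma pilot_series1E (R : realType) (F : nat -> R) :
  (forall n, 0 <= F n.+1) -> pilot_series1 F = (\sum_(i <oo) (F i.+1)%:E)%E.
Proof. by move=> F0; rewrite /pilot_series1 nneseries_shift1// => i; rewrite lee_fin. Qed.

Lemma psumE (R : realType) (a : nat -> R) n : psum a n = \sum_(i < n) a i.+1.
Proof. by rewrite /psum big_add1 big_mkord. Qed.

Definition trunc_powRN (R : realType) (p : R) (N n : nat) : R :=
  if (n <= N)%N then n%:R `^ (- p^-1) else 0.

Lemma trunc_powRN_series (R : realType) (p : R) N : 0 < p ->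
  pilot_series1 (fun n => trunc_powRN R p N n `^ p) =
  (\sum_(0 <= i < N) (i.+1%:R)^-1)%:E.
Proof.
move=> p0; rewrite pilot_series1E; last by move=> n; exact: powR_ge0.
rewrite -sumEFin -nneseries_trunc; last by move=> i; rewrite lee_fin invr_ge0.
apply: eq_eseriesr => i _; rewrite /trunc_powRN; case: ifP => _.
  by rewrite -powRrM mulNr mulVf ?gt_eqF// powR_inv1.
by rewrite powR0// gt_eqF.
Qed.

Lemma trunc_powRN_admissible (R : realType) (p : R) N : 0 < p -> (0 < N)%N ->
  admissible p (trunc_powRN R p N).
Proof.
move=> p0 N0; split; first by move=> n; rewrite /trunc_powRN; case: ifP; rewrite ?powR_ge0.
rewrite trunc_powRN_series// ltry andbT lte_fin.
rewrite -(prednK N0) big_nat_recl//= ltr_pwDl ?invr_gt0//.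
by apply: sumr_ge0 => i _; rewrite invr_ge0.
Qed.

Lemma psum_trunc_powRN (R : realType) (p : R) N n : (n <= N)%N ->
  psum (trunc_powRN R p N) n = \sum_(i < n) i.+1%:R `^ (- p^-1).
Proof.
move=> nN; rewrite psumE; apply: eq_bigr => i _.
by rewrite /trunc_powRN (leq_trans (ltn_ord i) nN).
Qed.

(** Three quantities fall short of their limits, each by a factor [rho]: the averages of [a], those
    of [b], and the truncated sums of [K]. It suffices that [rho ^+ 3] exceeds the ratio of [c] to
    the full constant. *)
Lemma bilinear_sharp (R : realType) (p q kappa c : R) (K : nat -> nat -> R) :
  1 < p -> p^-1 + q^-1 = 1 -> 0 < kappa ->
  (forall i j, 0 <= K i j) -> asymp_row_ge R K kappa ->
  0 < c -> c < p * q * kappa ->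
  exists a b : nat -> R, admissible p a /\ admissible q b /\
    (c%:E * poweR (pilot_series1 (fun n => powR (a n) p)) p^-1 *
            poweR (pilot_series1 (fun n => powR (b n) q)) q^-1 <=
     \sum_(j <oo) \sum_(i <oo)
       (K i j * (i.+1%:R `^ p^-1 * j.+1%:R `^ q^-1) *
         (psum a i.+1 / i.+1%:R) * (psum b j.+1 / j.+1%:R))%R%:E)%E.
Proof.
move=> p1 pq k0 K0 Krow c0 cpq; have q1 := conjugate_gt1 p1 pq.
have p0 : 0 < p by [lra]. have q0 : 0 < q by [lra].
have qp : q^-1 + p^-1 = 1 by rewrite addrC.
have pqk0 : 0 < p * q * kappa by rewrite !mulr_gt0.
pose t := c / (p * q * kappa).
have t0 : 0 < t by rewrite divr_gt0.
have t1 : t < 1 by rewrite ltr_pdivrMr// mul1r.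
(* Chosen so that [(1 - x) ^+ 3 >= 1 - 4 * x] at [x = (1 - t) / 4] reads [rho ^+ 3 >= t]. *)
pose rho := 1 - (1 - t) / 4.
have rho0 : 0 < rho by rewrite /rho; lra.
have rho1 : rho < 1 by rewrite /rho; lra.
have trho : t <= rho ^+ 3.
  have cube (x : R) : 0 < x -> x < 1 -> 1 - 4 * x <= (1 - x) ^+ 3.
    move=> x0 x1.
    have -> : (1 - x) ^+ 3 = 1 - 4 * x + (x * (1 - x ^+ 2) + 3 * x ^+ 2) by ring.
    rewrite lerDl addr_ge0//; last by rewrite mulr_ge0// sqr_ge0.
    by rewrite mulr_ge0 ?(ltW x0)// subr_ge0 expr_le1// ltW.
  by have := cube ((1 - t) / 4); rewrite -/rho; lra.
have crho : c <= p * rho * (q * rho) * (rho * kappa).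
  move: trho; rewrite ler_pdivrMr// => /le_trans; apply.
  by rewrite le_eqVlt; apply/orP; left; apply/eqP; ring.
have [m1 Hm1] := sum_powRN_asymp R p q rho p1 pq rho1.
have [m2 Hm2] := sum_powRN_asymp R q p rho q1 qp rho1.
pose m0 := maxn m1 m2.
have rk0 : 0 < rho * kappa by rewrite mulr_gt0.
have rk1 : rho * kappa < kappa by rewrite gtr_pMl.
have [N [N0 HN]] := asymp_row_ge_sum R K kappa (rho * kappa) m0 K0 Krow rk0 rk1.
pose a := trunc_powRN R p N; pose b := trunc_powRN R q N.
have admA : admissible p a by exact: trunc_powRN_admissible.
have admB : admissible q b by exact: trunc_powRN_admissible.
exists a, b; split=> //; split=> //.
rewrite !trunc_powRN_series//; set Z : R := \sum_(0 <= i < N) _ in HN *.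
have Z0 : 0 <= Z by apply: sumr_ge0 => i _; rewrite invr_ge0.
(* Both series equal the harmonic sum [Z], so the two roots multiply to [Z]. *)
rewrite -muleA !poweR_EFin -EFinM -powRD ?pq ?powRr1//; last by rewrite oner_eq0.
have psum0 x n : 0 < x -> 0 <= psum (trunc_powRN R x N) n.
  move=> x0; have [x0' _] := trunc_powRN_admissible R x N x0 N0.
  by rewrite psumE sumr_ge0.
have term0 i j : 0 <= K i j * (i.+1%:R `^ p^-1 * j.+1%:R `^ q^-1) *
    (psum a i.+1 / i.+1%:R) * (psum b j.+1 / j.+1%:R).
  by rewrite !mulr_ge0 ?powR_ge0 ?invr_ge0 ?psum0.
(* Only the square of indices from [m0] to [N] is kept: above [m0] both averages are near their
   asymptotics, below [N] the truncation is invisible. *)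
apply: (@le_trans _ _ (\sum_(m0 <= j < N) \sum_(m0 <= i < N)
    (p * rho * (q * rho) * K i j)%:E)%E).
  under eq_bigr => j _ do rewrite sumEFin -mulr_sumr.
  rewrite sumEFin -mulr_sumr lee_fin.
  apply: (@le_trans _ _ (p * rho * (q * rho) * (rho * kappa * Z))).
    by rewrite [leRHS]mulrA ler_wpM2r.
  by rewrite ler_wpM2l// !mulr_ge0// ltW.
apply: le_trans (nneseries_ge_sub _ _ m0 N _); last first.
  by move=> j; apply: nneseries_ge0 => i _ _; rewrite lee_fin.
rewrite big_nat_cond [leRHS]big_nat_cond; apply: lee_sum => j.
rewrite andbT => /andP[m0j jN].
apply: le_trans (nneseries_ge_sub _ _ m0 N _); last by move=> i; rewrite lee_fin.
rewrite big_nat_cond [leRHS]big_nat_cond; apply: lee_sum => i.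
rewrite andbT => /andP[m0i iN].
rewrite lee_fin.
have -> : K i j * (i.+1%:R `^ p^-1 * j.+1%:R `^ q^-1) *
    (psum a i.+1 / i.+1%:R) * (psum b j.+1 / j.+1%:R) =
  K i j * ((i.+1%:R `^ p^-1 * (psum a i.+1 / i.+1%:R)) *
           (j.+1%:R `^ q^-1 * (psum b j.+1 / j.+1%:R))) by ring.
rewrite [leLHS]mulrC ler_wpM2l// [leLHS]mulrC.
have half x y n (x1 : 1 < x) (xy : x^-1 + y^-1 = 1) : (n < N)%N ->
    rho * (y * n.+1%:R `^ y^-1) <= \sum_(i < n.+1) i.+1%:R `^ (- x^-1) ->
    y * rho <= n.+1%:R `^ x^-1 * (psum (trunc_powRN R x N) n.+1 / n.+1%:R).
  move=> nN; rewrite -(psum_trunc_powRN _ _ N)// => h.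
  have n0 : 0 < n.+1%:R :> R by [].
  rewrite mulrA ler_pdivlMr//.
  apply: le_trans (ler_wpM2l (powR_ge0 _ _) h).
  rewrite [leRHS](_ : _ = y * rho * (n.+1%:R `^ x^-1 * n.+1%:R `^ y^-1)); last by ring.
  by rewrite -powRD xy ?powRr1// oner_eq0.
have hA : q * rho <= i.+1%:R `^ p^-1 * (psum a i.+1 / i.+1%:R).
  by apply: half => //; apply: Hm1; rewrite (leq_trans _ m0i)// leq_maxl.
have hB : p * rho <= j.+1%:R `^ q^-1 * (psum b j.+1 / j.+1%:R).
  by apply: half => //; apply: Hm2; rewrite (leq_trans _ m0j)// leq_maxr.
by apply: ler_pM => //; rewrite mulr_ge0// ltW.
Qed.

(** * Powers and Hölder's inequality with extended values *)

Lemma gt0_lte_poweR (R : realType) (r : R) (x y : \bar R) :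
  0 < r -> (0 <= x -> x < y -> poweR x r < poweR y r)%E.
Proof.
move=> r0 x0 xy; rewrite ltNge; apply/negP => yx.
have y0 : (0 <= y)%E by rewrite (le_trans x0)// ltW.
have := @gt0_ler_poweR R r^-1 (ltW (_ : 0 < r^-1)) (poweR y r) (poweR x r).
rewrite !in_itv/= !leey !poweR_ge0 -!poweRrM mulfV ?gt_eqF// !poweRe1//.
by move=> /(_ _ isT isT yx); rewrite invr_gt0 leNgt xy => /(_ r0).
Qed.

(** Meant for inner sums of a double series, which are a priori extended reals; convergence of their
    [p]-th powers makes each one finite. *)
Lemma hoelder_nneseries_ereal (R : realType) (p q : R) (u : nat -> \bar R)
    (v : nat -> R) :
  0 < p -> 0 < q -> p^-1 + q^-1 = 1 ->
  (forall i, 0 <= u i)%E -> (forall i, 0 <= v i) ->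
  (\sum_(i <oo) poweR (u i) p < +oo)%E ->
  (\sum_(i <oo) (u i * (v i)%:E) <=
   poweR (\sum_(i <oo) poweR (u i) p) p^-1 *
   poweR (\sum_(i <oo) (v i `^ q)%:E) q^-1)%E.
Proof.
move=> p0 q0 pq u0 v0 Soo.
have ufin i : u i \is a fin_num.
  rewrite ge0_fin_numE// ltNge leye_eq; apply/negP => /eqP ui.
  move: Soo; rewrite (@nneseries_pinfty _ _ _ i)// => [n _|]; first exact: poweR_ge0.
  by rewrite ui poweRyr// gt_eqF.
under eq_eseriesr => i _ do rewrite -(fineK (ufin i)) -EFinM.
under [X in (_ <= poweR X _ * _)%E]eq_eseriesr => i _ do
  rewrite -(fineK (ufin i)) poweR_EFin.
apply: hoelder_nneseries => // i; exact: fine_ge0.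
Qed.

(** * Homogeneous kernels *)

Section kernel.
Variables (R : realType) (k : R -> R -> R) (r s lambda : R).
Hypothesis rs : r + s = lambda.
Hypothesis kpos : forall x y : R, 0 < x -> 0 < y -> 0 < k x y.
Hypothesis khom : forall u x y : R, 0 < u -> 0 < x -> 0 < y ->
  k (u * x) (u * y) = u `^ (- lambda) * k x y.

Local Notation f := (fun u : R => k u 1 * u `^ (r - 1)).

(** Scaling by [y^-1] turns [k x y] into a section of the kernel. Of the two factors [y^-1], the
    inner one is the mesh of a Riemann sum of [f], the outer one the decay of the row sum. *)
Lemma kernel_row (x y : R) : 0 < x -> 0 < y ->
  k x y * (x `^ (r - 1) * y `^ (s - 1)) = y^-1 * (y^-1 * f (y^-1 * x)).
Proof.
move=> x0 y0; have yi0 : 0 < y^-1 by rewrite invr_gt0.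
have yx0 : 0 < y^-1 * x by rewrite mulr_gt0.
have -> : k x y = y `^ (- lambda) * k (y^-1 * x) 1.
  by rewrite -khom// mulr1 mulVKf ?gt_eqF.
rewrite powRM ?ltW//.
have E : y `^ (- lambda) * y `^ (s - 1) = y^-1 * y^-1 * y^-1 `^ (r - 1).
  rewrite -!(powR_inv1 (ltW y0)) -powRrM -!powRD ?(gt_eqF y0) ?implybT//.
  by congr powR; rewrite -rs; ring.
transitivity (y `^ (- lambda) * y `^ (s - 1) * (k (y^-1 * x) 1 * x `^ (r - 1))).
  by ring.
by rewrite E; ring.
Qed.

(** Links the two sections of the kernel: the decrease of the second one becomes the hypothesis
    [fincr] on [f]. *)
Lemma kernel_inv (x : R) : 0 < x ->
  x ^+ 2 * f x = k 1 x^-1 * x^-1 `^ (s - 1).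
Proof.
move=> x0; have xi0 : 0 < x^-1 by rewrite invr_gt0.
have -> : k 1 x^-1 = x `^ lambda * k x 1.
  rewrite -{1}(mulVf (lt0r_neq0 x0)) -{2}(mulr1 x^-1) khom//.
  rewrite -(powR_inv1 (ltW x0)) -powRrM mulN1r opprK.
  by [].
rewrite -(powR_inv1 (ltW x0)) -powRrM -powR_mulrn ?(ltW x0)//.
transitivity (k x 1 * (x `^ 2%:R * x `^ (r - 1))); first by ring.
transitivity (k x 1 * (x `^ lambda * x `^ (-1 * (s - 1)))); last by ring.
rewrite -!powRD ?(gt_eqF x0) ?implybT//; congr (_ * powR _ _).
by rewrite -rs; ring.
Qed.

(* Indices are shifted by one: i and j stand for m = i + 1 and n = j + 1. *)
Definition kernel_mx (i j : nat) : R :=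
  k i.+1%:R j.+1%:R * (i.+1%:R `^ (r - 1) * j.+1%:R `^ (s - 1)).

Lemma kernel_mx_ge0 i j : 0 <= kernel_mx i j.
Proof. by rewrite !mulr_ge0 ?powR_ge0// ltW// kpos. Qed.

Lemma kernel_mx_row i j :
  kernel_mx i j = j.+1%:R^-1 * (j.+1%:R^-1 * f (j.+1%:R^-1 * i.+1%:R)).
Proof. exact: kernel_row. Qed.

(** The inner factor is the term of [riemann_sum_inv_le] at [t = i + 1]. *)
Lemma kernel_mx_col i j :
  kernel_mx i j = i.+1%:R^-1 * (i.+1%:R / j.+1%:R ^+ 2 * f (i.+1%:R / j.+1%:R)).
Proof.
rewrite kernel_mx_row [_^-1 * i.+1%:R]mulrC.
have H (x y z : R) : x != 0 -> y != 0 ->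
    y^-1 * (y^-1 * z) = x^-1 * (x / y ^+ 2 * z) by move=> x0 y0; field; rewrite ?x0 ?y0.
by apply: H; rewrite pnatr_eq0.
Qed.

(** * Row and column sums of the kernel matrix *)

Variable kr : R.
Hypothesis kmeas : measurable_fun [set xy : R * R | 0 < xy.1 /\ 0 < xy.2]
  (fun xy : R * R => k xy.1 xy.2).
Hypothesis hkr :
  (\int[lebesgue_measure]_(u in `]0%R, +oo[) (k u 1 * u `^ (r - 1))%:E)%E = kr%:E.
Hypothesis dec1 : decr_pos f.
Hypothesis dec2 : decr_pos (fun u => k 1 u * u `^ (s - 1)).

Lemma kernel_section_ge0 (u : R) : 0 < u -> 0 <= f u.
Proof. by move=> u0; rewrite mulr_ge0 ?powR_ge0// ltW// kpos. Qed.

Lemma measurable_kernel_section :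
  measurable_fun (`]0, +oo[%classic : set R) f.
Proof.
apply: measurable_funM; last first.
  by apply: measurable_funTS; exact: measurable_powR.
have E : [set xy : R * R | 0 < xy.1 /\ 0 < xy.2] =
    (`]0, +oo[%classic : set R) `*` (`]0, +oo[%classic : set R).
  by apply/seteqP; split => -[x y] /=; rewrite !in_itv/= !andbT.
rewrite (_ : (fun u => k u 1) = (fun xy => k xy.1 xy.2) \o (fun u => (u, 1)))//.
apply: (measurable_comp _ _ kmeas).
- by rewrite E; exact: measurableX.
- move=> _ [u /= + <-]; rewrite in_itv/= andbT => u0; split => //=.
- by apply: measurable_funTS; exact: measurable_fun_pair.
Qed.

Lemma kernel_mx_row_sum j :
  (\sum_(i <oo) (kernel_mx i j)%:E <= (kr / j.+1%:R)%:E)%E.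
Proof.
under eq_eseriesr => i _ do rewrite kernel_mx_row EFinM.
rewrite nneseriesZl; last first.
  by move=> i _; rewrite lee_fin mulr_ge0 ?kernel_section_ge0 ?mulr_gt0 ?invr_gt0.
rewrite mulrC EFinM -hkr lee_wpmul2l ?lee_fin ?invr_ge0//.
apply: (riemann_sum_le R f kernel_section_ge0 measurable_kernel_section dec1).
by rewrite invr_gt0.
Qed.

Lemma kernel_mx_col_sum i :
  (\sum_(j <oo) (kernel_mx i j)%:E <= (kr / i.+1%:R)%:E)%E.
Proof.
under eq_eseriesr => j _ do rewrite kernel_mx_col EFinM.
rewrite nneseriesZl; last first.
  by move=> j _; rewrite lee_fin mulr_ge0 ?kernel_section_ge0 ?divr_ge0 ?divr_gt0.
rewrite mulrC EFinM -hkr lee_wpmul2l ?lee_fin ?invr_ge0//.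
apply: (riemann_sum_inv_le R f kernel_section_ge0 measurable_kernel_section) => //.
move=> x y x0 xy; have y0 := lt_le_trans x0 xy.
by rewrite !kernel_inv// dec2// ?invr_gt0// lef_pV2.
Qed.

(** Choose [e] so that []e, 1/e]] already carries integral at least [c]. The conditions on [m] and
    [n] say that the nodes [(i + 1) / (j + 1)] span this interval, so the upper Riemann sum
    dominates its integral. *)
Lemma kernel_mx_asymp : asymp_row_ge R kernel_mx kr.
Proof.
move=> c ck.
have ckr : (c%:E < \int[lebesgue_measure]_(u in `]0%R, +oo[) (f u)%:E)%E.
  by rewrite hkr lte_fin.
have [e [e0 ce]] := itg_truncate R f kernel_section_ge0 measurable_kernel_section c ckr.
exists e; split=> // j m n mn me en.
have j0 : 0 < j.+1%:R :> R by [].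
have h0 : 0 < j.+1%:R^-1 :> R by rewrite invr_gt0.
under eq_bigr => i _ do rewrite kernel_mx_row.
rewrite -mulr_sumr mulrC ler_wpM2l ?invr_ge0//.
rewrite -lee_fin -sumEFin; apply: (le_trans ce).
apply: le_trans (riemann_sum_ge R f kernel_section_ge0 measurable_kernel_section
  dec1 _ _ _ h0 mn).
apply: (le_itg R f kernel_section_ge0 measurable_kernel_section) => //.
- move=> u /=; rewrite !in_itv/= => /andP[eu ue]; apply/andP; split.
    by apply: le_lt_trans eu; rewrite ler_pdivrMl// mulrC.
  by apply: (le_trans ue); rewrite ler_pdivlMl// ler_pdivrMr// mulrC.
- by apply: itv_pos; rewrite mulr_ge0 ?invr_ge0.
Qed.

(** * The left-hand sides in terms of averages *)

Variables p q : R.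
Hypotheses (p1 : 1 < p) (pq : p^-1 + q^-1 = 1).

Lemma powR_split (x u v t : R) : 0 < x -> t = u + v -> x `^ t = x `^ u * x `^ v.
Proof. by move=> x0 ->; rewrite powRD// (gt_eqF x0) implybT. Qed.

Definition average (a : nat -> R) (i : nat) : R := psum a i.+1 / i.+1%:R.

Lemma average_ge0 (a : nat -> R) i : (forall n, 0 <= a n) -> 0 <= average a i.
Proof. by move=> a0; rewrite divr_ge0// psumE sumr_ge0. Qed.

(** The summand of [schur_test] with [x i = i + 1] and [u = average a]. *)
Definition weighted_term (a : nat -> R) (i j : nat) : R :=
  kernel_mx i j * (i.+1%:R `^ p^-1 * j.+1%:R `^ q^-1) * average a i.

Lemma weighted_term_ge0 (a : nat -> R) i j :
  (forall n, 0 <= a n) -> 0 <= weighted_term a i j.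
Proof.
move=> a0; apply: mulr_ge0; last exact: average_ge0.
by rewrite mulr_ge0 ?kernel_mx_ge0// mulr_ge0// powR_ge0.
Qed.

Lemma weighted_termE (a : nat -> R) i j :
  i.+1%:R `^ (r - q^-1 - 1) * j.+1%:R `^ (s - p^-1) * k i.+1%:R j.+1%:R *
    psum a i.+1 = weighted_term a i j.
Proof.
have i0 : 0 < i.+1%:R :> R by []. have j0 : 0 < j.+1%:R :> R by [].
(* As [- 1/q = 1/p - 1], the exponent of [m] splits into [r - 1] for the matrix, [1/p] for the
   weight and [- 1] for the average. *)
rewrite (powR_split _ (r - 1) (p^-1 - 1))//; last by have := pq; lra.
rewrite [_ `^ (p^-1 - 1)](powR_split _ p^-1 (-1))// powR_inv1 ?ltW//.
rewrite (powR_split j.+1%:R (s - 1) q^-1)//; last by have := pq; lra.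
by rewrite /weighted_term /kernel_mx /average; ring.
Qed.

Lemma lhs2E (a : nat -> R) : (forall n, 0 <= a n) ->
  lhs2 k p q r s a =
  (\sum_(j <oo) poweR (\sum_(i <oo) (weighted_term a i j)%:E) p)%E.
Proof.
move=> a0; rewrite /lhs2 nneseries_shift1; last by move=> j; exact: poweR_ge0.
apply: eq_eseriesr => j _; congr poweR.
rewrite nneseries_shift1 => [|i]; last first.
  by rewrite weighted_termE lee_fin weighted_term_ge0.
by apply: eq_eseriesr => i _; rewrite weighted_termE.
Qed.

Lemma lhs1E (a b : nat -> R) : (forall n, 0 <= a n) -> (forall n, 0 <= b n) ->
  lhs1 k p q r s a b =
  (\sum_(j <oo) \sum_(i <oo) (weighted_term a i j * average b j)%:E)%E.
Proof.
move=> a0 b0.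
have E i j : i.+1%:R `^ (r - q^-1 - 1) * j.+1%:R `^ (s - p^-1 - 1) *
    k i.+1%:R j.+1%:R * psum a i.+1 * psum b j.+1 =
    weighted_term a i j * average b j.
  have j0 : 0 < j.+1%:R :> R by [].
  rewrite (powR_split j.+1%:R (s - p^-1) (-1))// powR_inv1 ?ltW//.
  by rewrite -weighted_termE /average; ring.
have T0 i j : (0 <= (weighted_term a i j * average b j)%:E)%E.
  by rewrite lee_fin mulr_ge0 ?weighted_term_ge0 ?average_ge0.
have inner j : (\sum_(1 <= m <oo) (m%:R `^ (r - q^-1 - 1) *
    j.+1%:R `^ (s - p^-1 - 1) * k m%:R j.+1%:R * psum a m * psum b j.+1)%R%:E =
    \sum_(i <oo) (weighted_term a i j * average b j)%:E)%E.
  rewrite nneseries_shift1 => [|i]; last by rewrite E.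
  by apply: eq_eseriesr => i _; rewrite E.
rewrite /lhs1 nneseries_shift1 => [|j]; last by rewrite inner nneseries_ge0.
by apply: eq_eseriesr => j _; rewrite inner.
Qed.

(** * The strict inequalities *)

Hypothesis kr0 : 0 < kr.

(** The exponents are free because [a] needs the pair [p, q] and [b] the pair [q, p]. *)
Lemma hardy_average (p' q' : R) (a : nat -> R) :
  1 < p' -> p'^-1 + q'^-1 = 1 -> admissible p' a ->
  (\sum_(i <oo) (average a i `^ p')%:E <
   (q' `^ p')%:E * pilot_series1 (fun n => powR (a n) p'))%E.
Proof.
move=> p1' pq' [a0 aS]; rewrite pilot_series1E in aS *; last first.
  by move=> n; exact: powR_ge0.
have := hardy (fun i => a i.+1) p1' pq' (fun i => a0 i.+1) aS.
by under eq_eseriesr => i _ do rewrite -psumE.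
Qed.

Lemma lhs2_lt (a : nat -> R) : admissible p a ->
  (lhs2 k p q r s a <
   ((q * kr) `^ p)%:E * pilot_series1 (fun n => powR (a n) p))%E.
Proof.
move=> aA; have [a0 _] := aA; have q1 := conjugate_gt1 p1 pq.
have p0 : 0 < p := lt_trans ltr01 p1. have q0 : 0 < q := lt_trans ltr01 q1.
rewrite lhs2E//.
apply: (@le_lt_trans _ _ ((kr `^ p)%:E * \sum_(i <oo) (average a i `^ p)%:E)%E).
  apply: (schur_test _ _ _ _ _ (fun i => i.+1%:R)) => //.
  - exact: ltW.
  - exact: kernel_mx_ge0.
  - by move=> i; exact: average_ge0.
  - exact: kernel_mx_row_sum.
  - exact: kernel_mx_col_sum.
rewrite powRM ?ltW// mulrC EFinM -muleA lte_pmul2l ?lte_fin ?powR_gt0//.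
exact: hardy_average.
Qed.

Lemma pilot_series1_fin (x : R) (a : nat -> R) : admissible x a ->
  exists2 S : R, 0 < S & pilot_series1 (fun n => powR (a n) x) = S%:E.
Proof.
move=> [_ /andP[S0 Soo]]; exists (fine (pilot_series1 (fun n => powR (a n) x))).
  by rewrite fine_gt0// S0.
by rewrite fineK// ge0_fin_numE// ltW.
Qed.

(** Hölder pairs the inner sums with the averages of [b], and Hardy bounds the latter. Keeping
    [lhs2] on the right lets the same bound serve the first inequality and the sharpness of the
    second. *)
Lemma lhs1_le (a b : nat -> R) : admissible p a -> admissible q b ->
  (lhs1 k p q r s a b <=
   poweR (lhs2 k p q r s a) p^-1 *
   (p%:E * poweR (pilot_series1 (fun n => powR (b n) q)) q^-1))%E.
Proof.
move=> aA bA; have [a0 _] := aA; have [b0 _] := bA.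
have q1 := conjugate_gt1 p1 pq.
have p0 : 0 < p := lt_trans ltr01 p1. have q0 : 0 < q := lt_trans ltr01 q1.
have [Sa _ SaE] := pilot_series1_fin _ _ aA.
have [Sb Sb0 SbE] := pilot_series1_fin _ _ bA.
have I0 j : (0 <= \sum_(i <oo) (weighted_term a i j)%:E)%E.
  by apply: nneseries_ge0 => i _ _; rewrite lee_fin weighted_term_ge0.
have oo : (lhs2 k p q r s a < +oo)%E.
  by apply: (lt_trans (lhs2_lt a aA)); rewrite SaE -EFinM ltry.
rewrite lhs1E//; rewrite lhs2E// in oo *.
rewrite (_ : (\sum_(j <oo) _)%E = (\sum_(j <oo)
    (\sum_(i <oo) (weighted_term a i j)%:E) * (average b j)%:E)%E); last first.
  apply: eq_eseriesr => j _; rewrite muleC -nneseriesZl.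
    by apply: eq_eseriesr => i _; rewrite -EFinM mulrC.
  by move=> i _; rewrite lee_fin weighted_term_ge0.
apply: le_trans (hoelder_nneseries_ereal _ _ _ _ _ p0 q0 pq I0 _ oo) _.
  by move=> j; exact: average_ge0.
rewrite lee_wpmul2l ?poweR_ge0//.
have qp : q^-1 + p^-1 = 1 by rewrite addrC.
have := hardy_average q p b q1 qp bA; rewrite SbE => /ltW bS.
rewrite poweR_EFin -EFinM.
have -> : p * Sb `^ q^-1 = (p `^ q * Sb) `^ q^-1.
  rewrite powRM ?powR_ge0 ?(ltW Sb0)// -powRrM mulfV ?gt_eqF// powRr1//.
  exact: ltW.
rewrite -poweR_EFin; apply: gt0_ler_poweR => //.
- by rewrite invr_ge0 ltW.
- rewrite in_itv/= leey andbT; apply: nneseries_ge0 => i _ _.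
  by rewrite lee_fin powR_ge0.
- by rewrite in_itv/= leey andbT lee_fin mulr_ge0 ?powR_ge0// ltW.
Qed.

(** All strictness comes from [lhs2_lt], through the strictly increasing power [1/p] and the
    positive finite factor of [b]. *)
Lemma lhs1_lt (a b : nat -> R) : admissible p a -> admissible q b ->
  (lhs1 k p q r s a b <
   (p * q * kr)%:E * poweR (pilot_series1 (fun n => powR (a n) p)) p^-1 *
   poweR (pilot_series1 (fun n => powR (b n) q)) q^-1)%E.
Proof.
move=> aA bA; apply: (le_lt_trans (lhs1_le _ _ aA bA)).
have q1 := conjugate_gt1 p1 pq.
have p0 : 0 < p := lt_trans ltr01 p1. have q0 : 0 < q := lt_trans ltr01 q1.
have [Sa Sa0 SaE] := pilot_series1_fin _ _ aA.
have [Sb Sb0 SbE] := pilot_series1_fin _ _ bA.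
have L0 : (0 <= lhs2 k p q r s a)%E.
  rewrite lhs2E; first by apply: nneseries_ge0 => j _ _; exact: poweR_ge0.
  by case: aA.
have pi0 : 0 < p^-1 by rewrite invr_gt0.
have := gt0_lte_poweR R p^-1 _ _ pi0 L0 (lhs2_lt a aA).
rewrite SaE SbE -EFinM !poweR_EFin (@powRM _ _ Sa) ?powR_ge0 ?(ltW Sa0)//.
rewrite -powRrM mulfV ?gt_eqF// powRr1; last by rewrite mulr_ge0// ltW.
move=> L; rewrite -!EFinM.
have -> : p * q * kr * Sa `^ p^-1 * Sb `^ q^-1 =
    q * kr * Sa `^ p^-1 * (p * Sb `^ q^-1) by ring.
by rewrite [ltRHS]EFinM lte_pmul2r// lte_fin mulr_gt0// powR_gt0.
Qed.

(** * Sharpness of the two constants *)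

Lemma lhs1_sharp (c : R) : 0 < c -> c < p * q * kr ->
  exists a b : nat -> R, admissible p a /\ admissible q b /\
    (c%:E * poweR (pilot_series1 (fun n => powR (a n) p)) p^-1 *
       poweR (pilot_series1 (fun n => powR (b n) q)) q^-1 <=
     lhs1 k p q r s a b)%E.
Proof.
move=> c0 ck.
have [a [b [aA [bA ab]]]] :=
  bilinear_sharp R p q kr c kernel_mx p1 pq kr0 kernel_mx_ge0 kernel_mx_asymp c0 ck.
exists a, b; split=> //; split=> //.
by rewrite lhs1E//; [case: aA|case: bA].
Qed.

(** Sharpness transfers from the first inequality: by [lhs1_le], a constant [c] in the second one
    corresponds to [p * c ^ (1/p)] in the first, below [p * q * kr] exactly when [c < (q * kr) ^ p].
    The factor of [b] then cancels. *)
Lemma lhs2_sharp (c : R) : 0 < c -> c < (q * kr) `^ p ->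
  exists a : nat -> R, admissible p a /\
    (c%:E * pilot_series1 (fun n => powR (a n) p) <= lhs2 k p q r s a)%E.
Proof.
move=> c0 ck.
have q1 := conjugate_gt1 p1 pq.
have p0 : 0 < p := lt_trans ltr01 p1. have q0 : 0 < q := lt_trans ltr01 q1.
have pi0 : 0 < p^-1 by rewrite invr_gt0.
have cp0 : 0 < c `^ p^-1 by rewrite powR_gt0.
have ck' : c `^ p^-1 < q * kr.
  have qk0 : 0 <= q * kr by rewrite mulr_ge0// ltW.
  rewrite -[ltRHS]powRr1// -(mulfV (lt0r_neq0 p0)) powRrM.
  by rewrite gt0_ltr_powR ?nnegrE ?powR_ge0// ltW.
have [||a [b [aA [bA]]]] := lhs1_sharp (p * c `^ p^-1).
- by rewrite mulr_gt0.
- by rewrite -mulrA ltr_pM2l.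
move=> /le_trans/(_ (lhs1_le _ _ aA bA)) h; exists a; split=> //.
move: h.
have [Sa Sa0 ->] := pilot_series1_fin _ _ aA.
have [Sb Sb0 ->] := pilot_series1_fin _ _ bA.
rewrite !poweR_EFin -!EFinM.
have -> : p * c `^ p^-1 * Sa `^ p^-1 * Sb `^ q^-1 =
    (c * Sa) `^ p^-1 * (p * Sb `^ q^-1).
  by rewrite powRM ?ltW//; ring.
rewrite [leLHS]EFinM lee_pmul2r//; last by rewrite lte_fin mulr_gt0// powR_gt0.
rewrite -poweR_EFin => h; rewrite leNgt; apply/negP => hl.
have L0 : (0 <= lhs2 k p q r s a)%E.
  rewrite lhs2E; first by apply: nneseries_ge0 => j _ _; exact: poweR_ge0.
  by case: aA.
have := gt0_lte_poweR R p^-1 _ _ pi0 L0 hl.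
by rewrite ltNge h.
Qed.

End kernel.

Theorem theorem4p1 (R : realType) (p q lambda r s : R) (k : R -> R -> R) (kr : R)
  (hp : 1 < p) (hpq : p^-1 + q^-1 = 1)
  (hlam : 0 < lambda) (hrs : r + s = lambda)
  (kpos : forall x y : R, 0 < x -> 0 < y -> 0 < k x y)
  (kmeas : measurable_fun [set xy : R * R | 0 < xy.1 /\ 0 < xy.2]
              (fun xy : R * R => k xy.1 xy.2))
  (khom : forall u x y : R, 0 < u -> 0 < x -> 0 < y ->
            k (u * x) (u * y) = u `^ (- lambda) * k x y)
  (hkr : (\int[lebesgue_measure]_(u in `]0%R, +oo[) (k u 1 * u `^ (r - 1))%:E)%E
           = kr%:E)
  (hkr_pos : 0 < kr)
  (hdec1 : decr_pos (fun u => k u 1 * u `^ (r - 1)))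
  (hdec2 : decr_pos (fun u => k 1 u * u `^ (s - 1)))
  (hsdec1 : strict_decr_somewhere (fun u => k u 1 * u `^ (r - 1)))
  (hsdec2 : strict_decr_somewhere (fun u => k 1 u * u `^ (s - 1))) :
  (forall a b : nat -> R, admissible p a -> admissible q b ->
     (lhs1 k p q r s a b
       < (p * q * kr)%:E * poweR (pilot_series1 (fun n => powR (a n) p)) p^-1
                         * poweR (pilot_series1 (fun n => powR (b n) q)) q^-1)%E)
  /\
  (forall a : nat -> R, admissible p a ->
     (lhs2 k p q r s a < ((q * kr) `^ p)%:E * pilot_series1 (fun n => powR (a n) p))%E)
  /\
  (forall c : R, 0 < c -> c < p * q * kr ->
     exists a b : nat -> R, admissible p a /\ admissible q b /\
       (c%:E * poweR (pilot_series1 (fun n => powR (a n) p)) p^-1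
             * poweR (pilot_series1 (fun n => powR (b n) q)) q^-1
          <= lhs1 k p q r s a b)%E)
  /\
  (forall c : R, 0 < c -> c < (q * kr) `^ p ->
     exists a : nat -> R, admissible p a /\
       (c%:E * pilot_series1 (fun n => powR (a n) p) <= lhs2 k p q r s a)%E).
Proof.
split; [|split; [|split]].
- by move=> a b; exact: (lhs1_lt R k r s lambda).
- by move=> a; exact: (lhs2_lt R k r s lambda).
- by move=> c; exact: (lhs1_sharp R k r s lambda).
- by move=> c; exact: (lhs2_sharp R k r s lambda).
Qed.
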